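(* Let $\epsilon>0$, let $\frac{\epsilon}{2}\le\gamma\le\epsilon$, and let $\{(x_1^{k},\ldots,x_N^{k},\lambda^{k})\}_{k\ge 0}$ be generated by the multi-block ADMM with penalty parameter $\gamma$ applied to the perturbed problem with $\mu=\epsilon(N-2)(N+1)$ (as described in the context), from the initial data $x_1^0,\ldots,x_N^0,\lambda^0$. For any integer $t>0$ define $$\bar x_i^t=\frac{1}{t+1}\sum_{k=0}^t x_i^{k+1}\quad (i=1,\ldots,N),\qquad \bar u^t=(\bar x_1^t,\ldots,\bar x_N^t),\qquad \bar\lambda^t=\frac1{t+1}\sum_{k=0}^t\lambda^{k+1}.$$ For any $(u^*,\lambda^* )\in\Omega^*$, with $u^*=(x_1^*,\ldots,x_N^* )$ and $\rho:=\|\lambda^*\|+1$, it holds for every integer $t>0$ that $$0\le f(\bar u^t)-f(u^* )+\rho\Big\|\sum_{i=1}^N A_i\bar x_i^t-b\Big\|\le \frac{\rho^2+\|\lambda^0\|^2}{\gamma(t+1)}+\frac{\gamma}{2(t+1)}\sum_{i=1}^{N-1}\Big\|\sum_{j=i+1}^N A_j(x_j^0-x_j^* )\Big\|^2+\frac{\epsilon(N-2)(N+1)}{2}\sum_{i=2}^N\|A_ix_i^*-A_ix_i^0\|^2 .$$ Consequently, when $t$ is of order $1/\epsilon^2$, $\bar u^t$ is an $\epsilon$-optimal solution of the original problem: for every constant $c>0$ there is a constant $C$, depending only on $c$, the problem data, the initial data and $(u^*,\lambda^* )$, but not on $\epsilon$, $\gamma$ or $t$, such that for every integer $t\ge c/\epsilon^2$,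 $t>0$, $$|f(\bar u^t)-f(u^* )|\le C\epsilon\qquad\text{and}\qquad \Big\|\sum_{i=1}^N A_i\bar x_i^t-b\Big\|\le C\epsilon .$$
   Context: Let $N\ge 3$. The original problem is $$\min\ f_1(x_1)+\cdots+f_N(x_N)\quad\text{s.t. } A_1x_1+\cdots+A_Nx_N=b,\ x_i\in\mathcal X_i,\ i=1,\ldots,N,$$ where $A_i\in\mathbf R^{p\times n_i}$, $b\in\mathbf R^p$, $\mathcal X_i\subset\mathbf R^{n_i}$ are closed convex sets and $f_i:\mathbf R^{n_i}\to\mathbf R$ are closed convex functions. Write $u=(x_1,\ldots,x_N)$, $f(u)=\sum_{i=1}^N f_i(x_i)$, and $\|\cdot\|$ for the Euclidean norm. Let $\Omega^*$ be the set of $(x_1^*,\ldots,x_N^*,\lambda^* )\in\mathcal X_1\times\cdots\times\mathcal X_N\times\mathbf R^p$ such that $\sum_{i=1}^N A_ix_i^*=b$ and, for each $i$, there is a subgradient $g_i(x_i^* )\in\partial f_i(x_i^* )$ with $(x_i-x_i^* )^\top(g_i(x_i^* )-A_i^\top\lambda^* )\ge 0$ for all $x_i\in\mathcal X_i$. It is assumed that $\Omega^*\neq\emptyset$. Perturbed problem: given $\epsilon>0$ and an initial point $u^0=(x_1^0,\ldots,x_N^0)$, put $\mu=\epsilon(N-2)(N+1)$ and $\tilde f_i(x_i)=f_i(x_i)+\frac{\mu}{2}\|A_ix_i-A_ix_i^0\|^2$ for $i=2,\ldots,N$; the perturbed problem is the original problem with $f_i$ replaced by $\tilde f_i$ for $i=2,\ldots,N$.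 ADMM for the perturbed problem: starting from $x_1^0,\ldots,x_N^0$ and $\lambda^0\in\mathbf R^p$, for $k=0,1,2,\ldots$, $$x_1^{k+1}\in\mathop{\rm argmin}_{x_1\in\mathcal X_1} f_1(x_1)+\frac\gamma2\Big\|A_1x_1+\sum_{j=2}^N A_jx_j^k-b-\frac1\gamma\lambda^k\Big\|^2,$$ $$x_i^{k+1}\in\mathop{\rm argmin}_{x_i\in\mathcal X_i}\tilde f_i(x_i)+\frac\gamma2\Big\|\sum_{j=1}^{i-1}A_jx_j^{k+1}+A_ix_i+\sum_{j=i+1}^N A_jx_j^k-b-\frac1\gamma\lambda^k\Big\|^2,\quad i=2,\ldots,N,$$ $$\lambda^{k+1}=\lambda^k-\gamma\Big(\sum_{j=1}^N A_jx_j^{k+1}-b\Big).$$ *)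

(* Defs.v *)
From HB Require Import structures.
From mathcomp Require Import all_boot all_order all_algebra.
From mathcomp Require Import boolp classical_sets reals topology normedtype convex.

Set Implicit Arguments.
Unset Strict Implicit.
Unset Printing Implicit Defensive.

Import Order.TTheory GRing.Theory Num.Theory.
Import numFieldNormedType.Exports.

Local Open Scope classical_set_scope.
Local Open Scope ring_scope.

(* The library's norm `|v| on matrices is the maximum norm; the Euclidean norm
   is needed here. *)
Definition enorm (R : realType) (m : nat) (v : 'cV[R]_m) : R :=
  Num.sqrt (\sum_i v i 0 ^+ 2).

Definition closed_function (R : realType) (m : nat) (g : 'cV[R]_m -> R) : Prop :=
  closed [set z : 'cV[R]_m * R | g z.1 <= z.2].

Definition subdifferential (R : realType) (m : nat) (g : 'cV[R]_m -> R)
    (x : 'cV[R]_m) : set 'cV[R]_m :=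
  [set s | forall y, g x + (s^T *m (y - x)) 0 0 <= g y].

Definition argmin (R : realType) (T : Type) (D : set T) (g : T -> R) : set T :=
  [set x | D x /\ forall y, D y -> g x <= g y].

(* Blocks are indexed by 'I_N, hence from 0: x_i is stored at the index of
   value i - 1, and the first, unperturbed block is the one of index value 0. *)
Definition blocks (R : realType) (N : nat) (n : 'I_N -> nat) : Type :=
  forall i : 'I_N, 'cV[R]_(n i).

Section MultiBlock.
Context (R : realType) (N : nat) (n : 'I_N -> nat) (p : nat).
Implicit Types (f : forall i : 'I_N, 'cV[R]_(n i) -> R)
  (A : forall i : 'I_N, 'M[R]_(p, n i)) (b : 'cV[R]_p)
  (X : forall i : 'I_N, set 'cV[R]_(n i)) (u : blocks R n).

Definition objective f u : R := \sum_i f i (u i).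

Definition residual A b u : 'cV[R]_p := \sum_i A i *m u i - b.

Definition Omega f A b X : set (blocks R n * 'cV[R]_p) :=
  [set z | [/\ forall i, X i (z.1 i),
               \sum_i A i *m z.1 i = b
             & forall i, exists2 g, subdifferential (f i) (z.1 i) g &
                 forall y, X i y ->
                   0 <= ((y - z.1 i)^T *m (g - (A i)^T *m z.2)) 0 0]].

Definition perturbed f A (mu : R) (u0 : blocks R n) (i : 'I_N)
    (y : 'cV[R]_(n i)) : R :=
  if (i == 0%N :> nat) then f i y
  else f i y + mu / 2 * enorm (A i *m y - A i *m u0 i) ^+ 2.

Definition pert_param (eps : R) : R := eps * (N%:R - 2) * (N%:R + 1).

Definition admm f A b X (gam : R) (u0 : blocks R n) (lam0 : 'cV[R]_p)
    (x : nat -> blocks R n) (lam : nat -> 'cV[R]_p) : Prop :=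
  [/\ x 0%N = u0, lam 0%N = lam0
    & forall k : nat,
      (forall i : 'I_N,
         argmin (X i)
           (fun y => f i y + gam / 2 *
              enorm (\sum_(j < N | (j < i)%N) A j *m x k.+1 j + A i *m y
                     + \sum_(j < N | (i < j)%N) A j *m x k j
                     - b - gam^-1 *: lam k) ^+ 2)
           (x k.+1 i))
      /\ lam k.+1 = lam k - gam *: residual A b (x k.+1)].

Definition ergodic (x : nat -> blocks R n) (t : nat) : blocks R n :=
  fun i => (t.+1%:R)^-1 *: \sum_(0 <= k < t.+1) x k.+1 i.

End MultiBlock.

(* Main.v *)
(** Write [d_i] for [A_i (x_i - x_i^* )] at the new iterate and [D_i] for the
    sum of the [d_j] with [j > i].  The optimality condition of each block
    subproblem, summed over the blocks, bounds the Lagrangian gap by the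
    telescoping terms [|lam - l|^2 / (2 gam)] and [gam / 2 * sum |D_i|^2], plus
    the anchoring error [mu / 2 * |A_i x_i^* - A_i x_i^0|^2], plus
    [gam / 2 * sum_i |d_i + D_i|^2], where [d_1 + D_1] is the residual.  The dual
    update pays for the first of these squares, and the strong convexity
    [mu / 2 * |d_i|^2] of the perturbation for the others.  Averaging, Jensen's
    inequality and the choice of the multiplier [l] of norm [rho] pointing
    against the averaged residual give the upper bound; the lower bound is the
    saddle-point inequality together with Cauchy-Schwarz. *)

Require Import Defs.
From mathcomp Require Import all_boot all_order all_algebra.
From mathcomp Require Import boolp classical_sets reals topology normedtype convex.
From mathcomp Require Import interval_inference ring lra.

Set Implicit Arguments.
Unset Strict Implicit.
Unset Printing Implicit Defensive.

Import Order.TTheory GRing.Theory Num.Theory.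
Import numFieldNormedType.Exports.

Local Open Scope classical_set_scope.
Local Open Scope ring_scope.

(** * Euclidean inner product and norm on column vectors *)

Section DotProduct.
Context (R : realType) (m : nat).
Implicit Types (u v w : 'cV[R]_m) (a : R).

Definition dotv u v : R := (u^T *m v) 0 0.

Lemma dotvE u v : dotv u v = \sum_i u i 0 * v i 0.
Proof. by rewrite /dotv mxE; apply: eq_bigr => i _; rewrite mxE. Qed.

Lemma dotvC u v : dotv u v = dotv v u.
Proof. by rewrite !dotvE; apply: eq_bigr => i _; rewrite mulrC. Qed.

Lemma dotvDl u v w : dotv (u + v) w = dotv u w + dotv v w.
Proof. by rewrite /dotv linearD mulmxDl mxE. Qed.

Lemma dotvZl a u v : dotv (a *: u) v = a * dotv u v.
Proof. by rewrite /dotv linearZ -scalemxAl mxE. Qed.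

Lemma dotvNl u v : dotv (- u) v = - dotv u v.
Proof. by rewrite -scaleN1r dotvZl mulN1r. Qed.

Lemma dotvBl u v w : dotv (u - v) w = dotv u w - dotv v w.
Proof. by rewrite dotvDl dotvNl. Qed.

Lemma dotvDr u v w : dotv w (u + v) = dotv w u + dotv w v.
Proof. by rewrite !(dotvC w) dotvDl. Qed.

Lemma dotvZr a u v : dotv v (a *: u) = a * dotv v u.
Proof. by rewrite !(dotvC v) dotvZl. Qed.

Lemma dotvNr u v : dotv v (- u) = - dotv v u.
Proof. by rewrite !(dotvC v) dotvNl. Qed.

Lemma dotvBr u v w : dotv w (u - v) = dotv w u - dotv w v.
Proof. by rewrite dotvDr dotvNr. Qed.

Lemma dot0v v : dotv 0 v = 0.
Proof. by rewrite -(scale0r v) dotvZl mul0r. Qed.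

Lemma dotv_suml (I : Type) (r : seq I) (P : pred I) (F : I -> 'cV[R]_m) v :
  dotv (\sum_(i <- r | P i) F i) v = \sum_(i <- r | P i) dotv (F i) v.
Proof.
by apply: (big_morph (dotv^~ v)) => [u w|]; rewrite ?dotvDl ?dot0v.
Qed.

Lemma dotv_sumr (I : Type) (r : seq I) (P : pred I) (F : I -> 'cV[R]_m) v :
  dotv v (\sum_(i <- r | P i) F i) = \sum_(i <- r | P i) dotv v (F i).
Proof.
by rewrite dotvC dotv_suml; apply: eq_bigr => i _; rewrite dotvC.
Qed.

Lemma dotv_ge0 u : 0 <= dotv u u.
Proof. by rewrite dotvE sumr_ge0// => i _; rewrite -expr2 sqr_ge0. Qed.

Lemma dotv_eq0 u : dotv u u = 0 -> u = 0.
Proof.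
rewrite dotvE => /psumr_eq0P u0; apply/matrixP => i j.
rewrite ord1 mxE; apply/eqP; rewrite -sqrf_eq0 expr2 u0// => k _.
by rewrite -expr2 sqr_ge0.
Qed.

Lemma enorm_ge0 u : 0 <= enorm u.
Proof. exact: sqrtr_ge0. Qed.

Lemma enorm_sqr u : enorm u ^+ 2 = dotv u u.
Proof.
rewrite /enorm sqr_sqrtr; last by rewrite sumr_ge0// => i _; rewrite sqr_ge0.
by rewrite dotvE; apply: eq_bigr => i _; rewrite expr2.
Qed.

Lemma enormN u : enorm (- u) = enorm u.
Proof.
by congr Num.sqrt; apply: eq_bigr => i _; rewrite mxE sqrrN.
Qed.

Lemma normr_dotv_le u v : `|dotv u v| <= enorm u * enorm v.
Proof.
rewrite -(@ler_pXn2r _ 2) ?nnegrE ?mulr_ge0 ?enorm_ge0//.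
rewrite exprMn !enorm_sqr real_normK ?num_real//.
have [v0|v0] := eqVneq (dotv v v) 0.
  by rewrite {1}(dotv_eq0 v0) v0 dotvC dot0v mulr0 expr0n.
have v_gt0 : 0 < dotv v v by rewrite lt_neqAle eq_sym v0 dotv_ge0.
(* This square equals [dotv v v] times the difference of the two sides of the squared Cauchy-Schwarz
   inequality. *)
have := dotv_ge0 (dotv v v *: u - dotv u v *: v).
rewrite !(dotvBl, dotvBr, dotvZl, dotvZr) (dotvC v u) => h.
by rewrite -subr_ge0 -(pmulr_rge0 _ v_gt0); lra.
Qed.

Lemma dotv_mul2_le u v : 2 * dotv u v <= dotv u u + dotv v v.
Proof.
by have := dotv_ge0 (u - v); rewrite !(dotvBl, dotvBr) (dotvC v u); lra.
Qed.

(** The square expands into a double sum in which each product is at most half the sum of two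
    squares; indices outside [P] count as zero vectors. *)
Lemma enorm_sumr_sqr_le (q : nat) (P : pred 'I_q) (v : 'I_q -> 'cV[R]_m) :
  enorm (\sum_(j | P j) v j) ^+ 2 <= q%:R * \sum_j enorm (v j) ^+ 2.
Proof.
rewrite enorm_sqr big_mkcond dotv_suml.
set w := fun j => if P j then v j else 0.
have wv j : dotv (w j) (w j) <= enorm (v j) ^+ 2.
  by rewrite enorm_sqr /w; case: ifP; rewrite ?dot0v ?dotv_ge0.
apply: (@le_trans _ _ (\sum_i \sum_j
    ((enorm (v i) ^+ 2 + enorm (v j) ^+ 2) / 2))).
  apply: ler_sum => i _; rewrite dotv_sumr; apply: ler_sum => j _.
  by have := dotv_mul2_le (w i) (w j); have := wv i; have := wv j; rewrite /w; lra.
set S := \sum_j enorm (v j) ^+ 2.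
have inner i : \sum_j (enorm (v i) ^+ 2 + enorm (v j) ^+ 2) / 2
    = (q%:R * enorm (v i) ^+ 2 + S) / 2.
  by rewrite -mulr_suml big_split/= sumr_const card_ord mulr_natl.
rewrite (eq_bigr _ (fun i _ => inner i)) -mulr_suml big_split/= sumr_const.
by rewrite card_ord -mulr_sumr -[S *+ q]mulr_natl -/S; lra.
Qed.

End DotProduct.

(** * Convexity along segments, first-order optimality, Jensen's inequality for averages *)

Section Convexity.
Context (R : realType) (m : nat).
Implicit Types (X : set 'cV[R]_m) (g : 'cV[R]_m -> R).

Lemma convex_set_segment X :
  convex_set (X : set (convex_lmodType 'cV[R]_m)) ->
  forall x y s, 0 <= s <= 1 -> X x -> X y -> X (x + s *: (y - x)).
Proof.
move=> cX x y s /andP[s0 s1] Xx Xy.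
have := cX y x (Itv01 s0 s1); rewrite !inE => /(_ Xy Xx).
have -> : x + s *: (y - x) = s *: y + (1 - s) *: x.
  by rewrite scalerBr scalerBl scale1r addrCA.
exact.
Qed.

Lemma convex_function_segment g :
  @convex_function R 'cV[R]_m setT g ->
  forall x y s, 0 <= s <= 1 ->
    g (x + s *: (y - x)) <= g x + s * (g y - g x).
Proof.
move=> cg x y s /andP[s0 s1].
have := cg (Itv01 s0 s1) y x; rewrite !inE => /(_ I I).
have -> : x + s *: (y - x) = s *: y + (1 - s) *: x.
  by rewrite scalerBr scalerBl scale1r addrCA.
by move=> /le_trans; apply; change (s * g y + (1 - s) * g x <= g x + s * (g y - g x)); lra.
Qed.

(* [L] is the derivative at [x] of the quadratic part [h] towards [y]; the bound
   comes from comparing [x] with [x + s *: (y - x)] as [s] tends to 0. *)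
Lemma argmin_variational X g (h : 'cV[R]_m -> R) x y (L K : R) :
  convex_set (X : set (convex_lmodType 'cV[R]_m)) ->
  @convex_function R 'cV[R]_m setT g ->
  argmin X (fun z => g z + h z) x -> X y ->
  (forall s, h (x + s *: (y - x)) = h x + s * L + s ^+ 2 * K) ->
  g x <= g y + L.
Proof.
move=> cX cg [Xx xmin] Xy hE.
have key s : 0 < s <= 1 -> g x - g y - L <= s * K.
  move=> /andP[s0 s1]; have s01 : 0 <= s <= 1 by rewrite ltW.
  have := xmin _ (convex_set_segment cX s01 Xx Xy).
  have := convex_function_segment cg x y s01; rewrite hE => gs gh.
  by rewrite -(ler_pM2l s0); lra.
rewrite leNgt; apply/negP => lt.
set D := g x - g y - L; have D0 : 0 < D by rewrite /D; lra.
(* The endpoint [s = 1] gives [D <= K], so [D / (2 * K)] is an admissible [s], at which [key] would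
   read [D <= D / 2]. *)
have DK : D <= K by have := key 1; rewrite /D mul1r => -> //; rewrite ltr01 lexx.
have K0 : 0 < K by lra.
have := key (D / (2 * K)); rewrite divr_gt0 ?mulr_gt0//=.
rewrite ler_pdivrMr ?mulr_gt0// mul1r.
have -> : D / (2 * K) * K = D / 2 by field; lra.
by move=> /(_ _); rewrite -/D => /(_ ltac:(lra)); lra.
Qed.

Definition mean (y : nat -> 'cV[R]_m) (t : nat) : 'cV[R]_m :=
  t.+1%:R^-1 *: \sum_(0 <= k < t.+1) y k.

Lemma mean0 y : mean y 0 = y 0%N.
Proof. by rewrite /mean big_nat1 invr1 scale1r. Qed.

(** The new mean lies on the segment from the old mean to the new term, so two-point convexity is
    enough for an induction on [t]. *)
Lemma meanS y t :
  mean y t.+1 = mean y t + t.+2%:R^-1 *: (y t.+1 - mean y t).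
Proof.
rewrite /mean [in LHS]big_nat_recr//= scalerDr scalerBr addrCA addrC.
congr (_ + _); rewrite scalerA -scalerBl; congr (_ *: _).
rewrite -(natr1 t.+1); have : 0 < t.+1%:R :> R by rewrite ltr0n.
by move: t.+1%:R => a a0; field; apply/andP; split; lra.
Qed.

Let inv_natS_01 t : 0 <= (t.+2%:R^-1 : R) <= 1.
Proof. by rewrite invr_ge0 ler0n/= invf_le1 ?ltr0n// ler1n. Qed.

Lemma convex_set_mean X y t :
  convex_set (X : set (convex_lmodType 'cV[R]_m)) ->
  (forall k, X (y k)) -> X (mean y t).
Proof.
move=> cX Xy; elim: t => [|t IH]; first by rewrite mean0.
by rewrite meanS; apply: convex_set_segment.
Qed.

Lemma convex_function_mean g y t : @convex_function R 'cV[R]_m setT g ->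
  g (mean y t) <= t.+1%:R^-1 * \sum_(0 <= k < t.+1) g (y k).
Proof.
move=> cg; elim: t => [|t IH]; first by rewrite mean0 big_nat1 invr1 mul1r.
rewrite meanS big_nat_recr//=.
apply: le_trans (convex_function_segment cg _ _ (inv_natS_01 t)) _.
have [s0 s1] := andP (inv_natS_01 t).
set S := \sum_(_ <= _ < _) _ in IH *.
set s := t.+2%:R^-1 in s0 s1 *.
have -> : s * (S + g (y t.+1)) = (1 - s) * (t.+1%:R^-1 * S) + s * g (y t.+1).
  rewrite mulrDr mulrA; congr (_ * _ + _).
  rewrite /s -(natr1 t.+1); have : 0 < t.+1%:R :> R by rewrite ltr0n.
  by move: t.+1%:R => a a0; field; apply/andP; split; lra.
have : (1 - s) * g (mean y t) <= (1 - s) * (t.+1%:R^-1 * S).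
  by apply: ler_wpM2l IH; rewrite subr_ge0.
by clearbody s; move: (t.+1%:R^-1 * S) => T; lra.
Qed.

End Convexity.

Lemma sum_ord_split (V : nmodType) (N : nat) (F : 'I_N -> V) (i : 'I_N) :
  \sum_j F j = \sum_(j < N | (j < i)%N) F j + F i + \sum_(j < N | (i < j)%N) F j.
Proof.
rewrite (bigID (fun j : 'I_N => (j < i)%N))/= -addrA; congr (_ + _).
rewrite (bigD1 i) ?ltnn//=; congr (_ + _); apply: eq_bigl => j.
by rewrite -leqNgt ltn_neqAle eq_sym andbC.
Qed.

(** * Cross terms created by updating the blocks one after another *)

Section Coupling.
Context (R : realType) (p : nat).

(** The suffix from index 0 is the whole sum. At most [q] suffixes remain, each with at most [q]
    terms: the two counts give a factor [q] apiece. *)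
Lemma sum_suffix_sqr_le (q : nat) (d : 'I_q.+1 -> 'cV[R]_p) : (0 < q)%N ->
  \sum_(i < q.+1 | (i.+1 < q.+1)%N) enorm (\sum_(j < q.+1 | (i <= j)%N) d j) ^+ 2
  <= enorm (\sum_j d j) ^+ 2
     + q%:R ^+ 2 * \sum_(i < q.+1 | (0 < i)%N) enorm (d i) ^+ 2.
Proof.
move=> q0; rewrite big_mkcond big_ord_recl/= ltnS q0 lerD2l.
rewrite [in leRHS]big_mkcond big_ord_recl/= add0r.
rewrite expr2 -mulrA mulr_natl -[q in _ *+ q]card_ord -sumr_const.
apply: ler_sum => i _; case: ifP => _; last first.
  by rewrite mulr_ge0 ?ler0n// sumr_ge0// => j _; rewrite sqr_ge0.
rewrite big_mkcond big_ord_recl/= add0r -big_mkcond/=.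
exact: enorm_sumr_sqr_le.
Qed.

(* The term of index 0 gives the square of the whole sum; the other at most
   [N - 1] ones give [(N - 1)^2], at most [(N - 2) (N + 1)] since [3 <= N]. *)
Lemma coupling_le (N : nat) (d d' : 'I_N -> 'cV[R]_p) : (3 <= N)%N ->
  - \sum_i dotv (d i) (\sum_(j < N | (i < j)%N) d' j
                       - \sum_(j < N | (i < j)%N) d j)
  <= (\sum_(i < N | (i.+1 < N)%N) enorm (\sum_(j < N | (i < j)%N) d' j) ^+ 2
      - \sum_(i < N | (i.+1 < N)%N) enorm (\sum_(j < N | (i < j)%N) d j) ^+ 2) / 2
     + enorm (\sum_j d j) ^+ 2 / 2
     + (N%:R - 2) * (N%:R + 1) / 2 * \sum_(i < N | (0 < i)%N) enorm (d i) ^+ 2.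
Proof.
move=> hN.
(* The product with [D'] is bounded through [|D' + v|^2 >= 0]; the product with [D] comes exactly
   from expanding [|v + D|^2]. *)
have young (v D D' : 'cV[R]_p) : - dotv v (D' - D)
    <= (enorm D' ^+ 2 - enorm D ^+ 2) / 2 + enorm (v + D) ^+ 2 / 2.
  have := dotv_ge0 (D' + v).
  rewrite !enorm_sqr !(dotvDl, dotvDr, dotvNr) (dotvC D v) (dotvC D' v); lra.
(* The last tail is empty, so the sums of squares may stop before the last block. *)
have last_block (i : 'I_N) : ~~ (i.+1 < N)%N ->
    dotv (d i) (\sum_(j < N | (i < j)%N) d' j - \sum_(j < N | (i < j)%N) d j) = 0.
  rewrite -leqNgt => Ni.
  have nil (j : 'I_N) : (i < j)%N = false.
    by apply/negbTE; rewrite -leqNgt -ltnS (leq_trans (ltn_ord j)).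
  by rewrite !big_pred0// subrr dotvC dot0v.
rewrite (bigID (fun i : 'I_N => (i.+1 < N)%N))/= [X in _ + X]big1 ?addr0; last first.
  by move=> i; apply: last_block.
apply: (@le_trans _ _ (\sum_(i < N | (i.+1 < N)%N)
  ((enorm (\sum_(j < N | (i < j)%N) d' j) ^+ 2
    - enorm (\sum_(j < N | (i < j)%N) d j) ^+ 2) / 2
   + enorm (\sum_(j < N | (i <= j)%N) d j) ^+ 2 / 2))).
  rewrite -sumrN; apply: ler_sum => i _.
  have -> : \sum_(j < N | (i <= j)%N) d j = d i + \sum_(j < N | (i < j)%N) d j.
    rewrite (bigD1 i)//=; congr (_ + _); apply: eq_bigl => j.
    by rewrite ltn_neqAle eq_sym andbC.
  exact: young.
rewrite big_split/= -!mulr_suml sumrB -addrA lerD2l.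
case: N hN d d' {young last_block} => [//|q] hN d d'.
have := sum_suffix_sqr_le d (ltnW hN : (0 < q)%N).
have : 2 <= q%:R :> R by rewrite ler_nat.
have : 0 <= \sum_(i < q.+1 | (0 < i)%N) enorm (d i) ^+ 2.
  by apply: sumr_ge0 => i _; rewrite sqr_ge0.
rewrite -(natr1 q).
move: (\sum_(i < q.+1 | (0 < i)%N) _) (q%:R : R) => S r S0 r2.
(* Here [r] is [N - 1], and [(N - 2) * (N + 1) - (N - 1)^2 = r - 2]. *)
have : 0 <= (r - 2) * S by rewrite mulr_ge0// subr_ge0.
by move=> rS le; lra.
Qed.

End Coupling.

(** * Descent estimates for the ADMM iterates and their averages *)

Section Admm.
Context (R : realType) (N : nat) (hN : (3 <= N)%N)
    (p : nat) (n : 'I_N -> nat)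
    (f : forall i : 'I_N, 'cV[R]_(n i) -> R)
    (A : forall i : 'I_N, 'M[R]_(p, n i)) (b : 'cV[R]_p)
    (X : forall i : 'I_N, set 'cV[R]_(n i))
    (X_convex : forall i, convex_set (X i : set (convex_lmodType 'cV[R]_(n i))))
    (f_convex : forall i, @convex_function R 'cV[R]_(n i) setT (f i))
    (u0 us : blocks R n) (lam0 : 'cV[R]_p).
Hypotheses (Xus : forall i, X (us i)) (us_feasible : \sum_i A i *m us i = b).

Lemma ergodicE (x : nat -> blocks R n) t i :
  ergodic x t i = mean (fun k => x k.+1 i) t.
Proof. by []. Qed.

Lemma residual_ergodic (x : nat -> blocks R n) t :
  residual A b (ergodic x t)
    = t.+1%:R^-1 *: \sum_(0 <= k < t.+1) residual A b (x k.+1).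
Proof.
rewrite /residual sumrB sumr_const_nat subn0 scalerBr -[b *+ _]scaler_nat scalerA.
rewrite mulVf ?pnatr_eq0// scale1r exchange_big/= scaler_sumr; congr (_ - _).
by apply: eq_bigr => i _; rewrite /ergodic -scalemxAr mulmx_sumr.
Qed.

Lemma objective_ergodic (x : nat -> blocks R n) t :
  objective f (ergodic x t)
    <= t.+1%:R^-1 * \sum_(0 <= k < t.+1) objective f (x k.+1).
Proof.
rewrite /objective exchange_big/= mulr_sumr; apply: ler_sum => i _.
exact: convex_function_mean.
Qed.

Lemma residual_sub (u : blocks R n) :
  residual A b u = \sum_i A i *m (u i - us i).
Proof.
by rewrite /residual -us_feasible -sumrB; apply: eq_bigr => i _; rewrite mulmxBr.
Qed.

Section Iterates.
Context (gam mu : R) (x : nat -> blocks R n) (lam : nat -> 'cV[R]_p).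
Hypotheses (gam_gt0 : 0 < gam) (mu_ge0 : 0 <= mu)
  (adm : admm (perturbed f A mu u0) A b X gam u0 lam0 x lam).

Definition deviation k i := A i *m (x k i - us i).
Definition tail_sum k (i : 'I_N) := \sum_(j < N | (i < j)%N) deviation k j.
Definition offset i := A i *m us i - A i *m u0 i.
(** The primal part of the Lyapunov function. *)
Definition energy k := \sum_(i < N | (i.+1 < N)%N) enorm (tail_sum k i) ^+ 2.

(** This is [argmin_variational] towards [us i], with [f i] as the convex part and both the
    perturbation and the penalty in the quadratic part. The tail difference appears because later
    blocks still sit at iterate [k]. *)
Lemma admm_block_le k i :
  f (x k.+1 i) - f (us i) <= dotv (deviation k.+1 i) (lam k.+1)
    - gam * dotv (deviation k.+1 i) (tail_sum k i - tail_sum k.+1 i)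
    + (if (0 < i)%N then mu / 2 * (enorm (offset i) ^+ 2 - enorm (deviation k.+1 i) ^+ 2) else 0).
Proof.
have [_ _ /(_ k) [/(_ i) xmin lamS]] := adm.
set s1 := \sum_(j < N | (j < i)%N) _ in xmin.
set s2 := \sum_(j < N | (i < j)%N) _ in xmin.
(* A zero weight on the first block lets one computation serve all blocks. *)
set mui := if (0 < i)%N then mu else 0.
pose h y := mui / 2 * enorm (A i *m y - A i *m u0 i) ^+ 2
  + gam / 2 * enorm (s1 + A i *m y + s2 - b - gam^-1 *: lam k) ^+ 2.
have {}xmin : argmin (@X i) (fun y => f y + h y) (x k.+1 i).
  have [Xx xle] := xmin; split=> // y /xle.
  by rewrite /perturbed /h /mui lt0n; case: ifP => _ /=; lra.
pose c := s1 + A i *m x k.+1 i + s2 - b - gam^-1 *: lam k.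
pose a := A i *m x k.+1 i - A i *m u0 i.
have hE s : h (x k.+1 i + s *: (us i - x k.+1 i))
   = h (x k.+1 i) + s * (- (mui * dotv (deviation k.+1 i) a + gam * dotv (deviation k.+1 i) c))
     + s ^+ 2 * ((mui + gam) / 2 * enorm (deviation k.+1 i) ^+ 2).
  rewrite /h mulmxDr -scalemxAr -(opprB (x k.+1 i)) mulmxN -/(deviation k.+1 i).
  rewrite -/a -/c.
  have -> : A i *m x k.+1 i + s *: - deviation k.+1 i - A i *m u0 i = a - s *: deviation k.+1 i.
    by rewrite scalerN addrAC.
  have -> : s1 + (A i *m x k.+1 i + s *: - deviation k.+1 i) + s2 - b - gam^-1 *: lam k
          = c - s *: deviation k.+1 i.
    by rewrite /c scalerN !addrA -!(addrAC _ (- (s *: _))).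
  move: (deviation k.+1 i) a c => v a' c'.
  by rewrite !enorm_sqr !(dotvBl, dotvBr, dotvZl, dotvZr) (dotvC c') (dotvC a'); lra.
have := argmin_variational (@X_convex i) (@f_convex i) xmin (Xus i) hE.
(* The dual update absorbs the full residual into [lam k.+1], leaving only the change in the blocks
   after [i]. *)
have cE : c = tail_sum k i - tail_sum k.+1 i - gam^-1 *: lam k.+1.
  rewrite lamS scalerBr scalerA mulVf ?gt_eqF// scale1r.
  rewrite /residual (sum_ord_split _ i) -/s1 /c /tail_sum /deviation.
  rewrite -sumrB.
  have -> : \sum_(j < N | (i < j)%N) (A j *m (x k j - us j) - A j *m (x k.+1 j - us j))
     = s2 - \sum_(j < N | (i < j)%N) A j *m x k.+1 j.
    by rewrite /s2 -sumrB; apply: eq_bigr => j _; rewrite !mulmxBr opprB addrA subrK.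
  move: (\sum_(j < N | (i < j)%N) A j *m x k.+1 j) (A i *m _) (gam^-1 *: _).
  move=> t v l.
  by apply/matrixP => i' j'; rewrite !mxE; ring.
have aE : a = deviation k.+1 i + offset i by rewrite /a /deviation /offset mulmxBr addrA subrK.
rewrite cE aE; move: (deviation k.+1 i) (offset i) (tail_sum k i - tail_sum k.+1 i) => v w t.
have gV : gam * (gam^-1 * dotv v (lam k.+1)) = dotv v (lam k.+1).
  by rewrite mulVKf// gt_eqF.
rewrite !(dotvBr, dotvDr, dotvZr) mulrBr gV /mui; case: ifP => _; last by lra.
(* [-2 v.(v + w) = |w|^2 - |v|^2 - |v + w|^2], and the last square is dropped. *)
have := mulr_ge0 mu_ge0 (dotv_ge0 (v + w)).
by rewrite !enorm_sqr !(dotvDl, dotvDr) (dotvC w v); lra.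
Qed.

(** After summing over blocks, the term [gam / 2 * |r|^2] from [coupling_le] cancels against [dual],
    and the hypothesis on [mu] absorbs the squares of the deviations. *)
Lemma admm_step_le k (l : 'cV[R]_p) : gam * ((N%:R - 2) * (N%:R + 1)) <= mu ->
  objective f (x k.+1) - objective f us - dotv l (residual A b (x k.+1))
  <= (enorm (lam k - l) ^+ 2 - enorm (lam k.+1 - l) ^+ 2) / (2 * gam)
     + gam / 2 * (energy k - energy k.+1)
     + mu / 2 * \sum_(i < N | (0 < i)%N) enorm (offset i) ^+ 2.
Proof.
move=> gam_mu.
have [_ _ /(_ k) [_ lamS]] := adm.
pose r := residual A b (x k.+1).
have dr : \sum_i deviation k.+1 i = r by rewrite /r residual_sub.
have obj : objective f (x k.+1) - objective f us <= dotv r (lam k.+1)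
    - gam * (\sum_i dotv (deviation k.+1 i) (tail_sum k i - tail_sum k.+1 i))
    + (mu / 2 * \sum_(i < N | (0 < i)%N) enorm (offset i) ^+ 2
       - mu / 2 * \sum_(i < N | (0 < i)%N) enorm (deviation k.+1 i) ^+ 2).
  rewrite -dr dotv_suml mulr_sumr /objective -!sumrB -mulrBr -sumrB mulr_sumr.
  rewrite [X in _ + X]big_mkcond -big_split/=.
  by apply: ler_sum => i _; apply: admm_block_le.
have := coupling_le (deviation k.+1) (deviation k) hN.
rewrite -(ler_pM2l gam_gt0) dr -/(energy k) -/(energy k.+1) => coup.
have S0 : 0 <= \sum_(i < N | (0 < i)%N) enorm (deviation k.+1 i) ^+ 2.
  by apply: sumr_ge0 => i _; rewrite sqr_ge0.
have absorb := ler_wpM2r S0 gam_mu.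
have dual : dotv r (lam k.+1) - dotv l r
    = (enorm (lam k - l) ^+ 2 - enorm (lam k.+1 - l) ^+ 2) / (2 * gam)
      - gam / 2 * enorm r ^+ 2.
  have -> : lam k = lam k.+1 + gam *: r by rewrite lamS subrK.
  move: (r) (lam k.+1) => v w.
  rewrite !enorm_sqr !(dotvBl, dotvBr, dotvDl, dotvDr, dotvZl, dotvZr).
  by rewrite (dotvC w v) (dotvC l v) (dotvC l w); field; rewrite gt_eqF.
rewrite -/r; move: obj coup absorb dual; rewrite /tail_sum.
by set Z := \sum_i dotv _ _; lra.
Qed.

(** The multiplier [l] stays free so that it can later depend on the averaged iterate. The residual
    averages exactly; only the objective needs Jensen. *)
Lemma ergodic_gap_le (l : 'cV[R]_p) t : gam * ((N%:R - 2) * (N%:R + 1)) <= mu ->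
  objective f (ergodic x t) - objective f us
    - dotv l (residual A b (ergodic x t))
  <= enorm (lam0 - l) ^+ 2 / (2 * gam * t.+1%:R)
     + gam / (2 * t.+1%:R)
       * (\sum_(i < N | (i.+1 < N)%N)
            enorm (\sum_(j < N | (i < j)%N) A j *m (u0 j - us j)) ^+ 2)
     + mu / 2 * \sum_(i < N | (0 < i)%N) enorm (A i *m us i - A i *m u0 i) ^+ 2.
Proof.
move=> gam_mu; have [x0 l0 _] := adm.
(* [pot] decreases by at least [gap k - M] at each step; its final value is nonnegative and is
   discarded. *)
pose pot k := enorm (lam k - l) ^+ 2 / (2 * gam) + gam / 2 * energy k.
pose gap k := objective f (x k.+1) - objective f us
  - dotv l (residual A b (x k.+1)).
set M := mu / 2 * _.
have energy_ge0 k : 0 <= energy k.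
  by apply: sumr_ge0 => i _; rewrite sqr_ge0.
have pot_ge0 k : 0 <= pot k.
  have := ltW gam_gt0 => gam_ge0.
  apply: addr_ge0; last by rewrite mulr_ge0// divr_ge0.
  by rewrite divr_ge0 ?sqr_ge0 ?mulr_ge0.
have telescope s : \sum_(0 <= k < s) gap k <= pot 0%N - pot s + s%:R * M.
  elim: s => [|s IH]; first by rewrite big_geq// subrr mul0r addr0.
  rewrite big_nat_recr//= -natr1.
  by have := admm_step_le s l gam_mu; rewrite -/(gap s) -/M; move: IH; rewrite /pot; lra.
have T0 : 0 < t.+1%:R :> R by rewrite ltr0n.
have avg : objective f (ergodic x t) - objective f us
    - dotv l (residual A b (ergodic x t))
    <= t.+1%:R^-1 * \sum_(0 <= k < t.+1) gap k.
  rewrite /gap !sumrB sumr_const_nat subn0 -[objective f us *+ _]mulr_natl.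
  rewrite residual_ergodic dotvZr dotv_sumr !mulrBr mulKf ?gt_eqF//.
  by rewrite !lerD2r objective_ergodic.
apply: le_trans avg _; rewrite ler_pdivrMl//.
apply: le_trans (telescope _) _.
have -> : \sum_(i < N | (i.+1 < N)%N)
    enorm (\sum_(j < N | (i < j)%N) A j *m (u0 j - us j)) ^+ 2 = energy 0.
  by rewrite /energy /tail_sum /deviation x0.
have -> : t.+1%:R * (enorm (lam0 - l) ^+ 2 / (2 * gam * t.+1%:R)
    + gam / (2 * t.+1%:R) * energy 0 + M) = pot 0%N + t.+1%:R * M.
  by rewrite /pot l0; field; rewrite !gt_eqF.
by rewrite lerD2r gerBl.
Qed.

End Iterates.

(** The saddle-point inequality and Cauchy-Schwarz cost [enorm lams] times the residual norm. The
    extra [1] in the weight leaves one residual norm, which later yields the feasibility rate. *)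
Lemma residual_le_gap (lams : 'cV[R]_p) (u : blocks R n) :
  Omega f A b X (us, lams) -> (forall i, X (u i)) ->
  enorm (residual A b u) <= objective f u - objective f us
    + (enorm lams + 1) * enorm (residual A b u).
Proof.
move=> [/= _ _ opt] Xu.
have gap : dotv lams (residual A b u) <= objective f u - objective f us.
  rewrite residual_sub dotv_sumr -sumrB; apply: ler_sum => i _.
  have [g /(_ (u i)) sub /(_ _ (Xu i))] := opt i.
  rewrite -/(dotv g (u i - us i)) in sub.
  rewrite -/(dotv _ _) dotvBr (dotvC _ g) subr_ge0.
  have -> : dotv (u i - us i) ((A i)^T *m lams) = dotv lams (A i *m (u i - us i)).
    by rewrite dotvC /dotv trmx_mul trmxK mulmxA.
  by move: sub; lra.
have := normr_dotv_le lams (residual A b u).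
by rewrite ler_norml => /andP[le _]; lra.
Qed.

End Admm.

(** * Choice of the multiplier, final bounds and rate *)

Lemma exists_aligned (R : realType) (p : nat) (a : R) (r : 'cV[R]_p) :
  exists2 l : 'cV[R]_p, enorm l ^+ 2 <= a ^+ 2 & dotv l r = a * enorm r.
Proof.
have [r0|r0] := eqVneq (enorm r) 0.
  exists 0; first by rewrite enorm_sqr dot0v sqr_ge0.
  by rewrite dot0v r0 mulr0.
exists ((a / enorm r) *: r).
  rewrite enorm_sqr dotvZl dotvZr -enorm_sqr.
  by rewrite (_ : _ * _ = a ^+ 2)//; field.
by rewrite dotvZl -enorm_sqr; field.
Qed.

Theorem theorem3p2 (R : realType) (N : nat) (hN : (3 <= N)%N)
    (p : nat) (n : 'I_N -> nat)
    (f : forall i : 'I_N, 'cV[R]_(n i) -> R)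
    (A : forall i : 'I_N, 'M[R]_(p, n i)) (b : 'cV[R]_p)
    (X : forall i : 'I_N, set 'cV[R]_(n i))
    (X_closed : forall i, closed (X i))
    (X_convex : forall i, convex_set (X i : set (convex_lmodType 'cV[R]_(n i))))
    (f_closed : forall i, closed_function (f i))
    (f_convex : forall i, @convex_function R 'cV[R]_(n i) setT (f i))
    (Omega_nonempty : Omega f A b X !=set0)
    (u0 : blocks R n) (lam0 : 'cV[R]_p)
    (us : blocks R n) (lams : 'cV[R]_p)
    (us_opt : Omega f A b X (us, lams)) :
  let rho := enorm lams + 1 in
  (forall (eps gam : R) (x : nat -> blocks R n) (lam : nat -> 'cV[R]_p),
     0 < eps -> eps / 2 <= gam <= eps ->
     admm (perturbed f A (pert_param N eps) u0) A b X gam u0 lam0 x lam ->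
     forall t : nat, (0 < t)%N ->
     0 <= objective f (ergodic x t) - objective f us
          + rho * enorm (residual A b (ergodic x t))
       <= (rho ^+ 2 + enorm lam0 ^+ 2) / (gam * (t%:R + 1))
          + gam / (2 * (t%:R + 1))
            * (\sum_(i < N | (i.+1 < N)%N)
                 enorm (\sum_(j < N | (i < j)%N) A j *m (u0 j - us j)) ^+ 2)
          + eps * (N%:R - 2) * (N%:R + 1) / 2
            * (\sum_(i < N | (0 < i)%N)
                 enorm (A i *m us i - A i *m u0 i) ^+ 2))
  /\
  (forall c : R, 0 < c -> exists C : R,
     forall (eps gam : R) (x : nat -> blocks R n) (lam : nat -> 'cV[R]_p),
     0 < eps -> eps / 2 <= gam <= eps ->
     admm (perturbed f A (pert_param N eps) u0) A b X gam u0 lam0 x lam ->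
     forall t : nat, (0 < t)%N -> c / eps ^+ 2 <= t%:R ->
     `|objective f (ergodic x t) - objective f us| <= C * eps
     /\ enorm (residual A b (ergodic x t)) <= C * eps).
Proof.
move=> rho.
have N3 : 3 <= N%:R :> R by rewrite ler_nat.
set Q := \sum_(i < N | (i.+1 < N)%N) _; set E := \sum_(i < N | (0 < i)%N) _.
have Q0 : 0 <= Q by apply: sumr_ge0 => i _; rewrite sqr_ge0.
have E0 : 0 <= E by apply: sumr_ge0 => i _; rewrite sqr_ge0.
have rho1 : 1 <= rho by rewrite /rho lerDr enorm_ge0.
set P := rho ^+ 2 + enorm lam0 ^+ 2.
have P0 : 0 <= P by rewrite addr_ge0 ?sqr_ge0.
set M := (N%:R - 2) * (N%:R + 1) : R.
have M0 : 0 <= M by rewrite mulr_ge0; lra.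
(* The lower side is the residual norm rather than 0, so both conclusions follow from this one
   estimate. *)
have bounds (eps gam : R) (x : nat -> blocks R n) (lam : nat -> 'cV[R]_p) :
    0 < eps -> eps / 2 <= gam <= eps ->
    admm (perturbed f A (pert_param N eps) u0) A b X gam u0 lam0 x lam ->
    forall t, enorm (residual A b (ergodic x t)) <=
      objective f (ergodic x t) - objective f us
        + rho * enorm (residual A b (ergodic x t)) <=
      P / (gam * (t%:R + 1)) + gam / (2 * (t%:R + 1)) * Q
        + eps * (N%:R - 2) * (N%:R + 1) / 2 * E.
  move=> eps0 /andP[eps_gam gam_eps] adm t.
  have gam0 : 0 < gam by lra.
  have muE : pert_param N eps = eps * M by rewrite /pert_param /M mulrA.
  have mu0 : 0 <= pert_param N eps by rewrite muE mulr_ge0// ltW.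
  have gamM : gam * M <= pert_param N eps by rewrite muE ler_wpM2r.
  have [/= Xus us_feasible _] := us_opt; apply/andP; split.
    apply: residual_le_gap us_opt _ => // i; rewrite ergodicE.
    apply: convex_set_mean => // k.
    by have [_ _ /(_ k) [/(_ i) [Xx _] _]] := adm.
  (* Aligning [l] with the negated residual turns the linear term into the penalty [rho * |r|]. *)
  have [l l_le lE] := exists_aligned rho (- residual A b (ergodic x t)).
  have {}lE : rho * enorm (residual A b (ergodic x t))
      = - dotv l (residual A b (ergodic x t)).
    by move: lE; rewrite dotvNr enormN => ->.
  rewrite lE.
  apply: le_trans (ergodic_gap_le hN X_convex f_convex Xus us_feasible gam0 mu0
    adm l t gamM) _ => {us_feasible}.
  rewrite -/Q -/E /pert_param (natr1 t) lerD2r lerD2r.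
  have T0 : 0 < t.+1%:R :> R by rewrite ltr0n.
  have -> : P / (gam * t.+1%:R) = 2 * P / (2 * gam * t.+1%:R).
    by field; rewrite !gt_eqF.
  apply: ler_wpM2r; first by rewrite invr_ge0 ?mulr_ge0// ltW.
  (* This gives [|lam0 - l|^2 <= 2 |lam0|^2 + 2 |l|^2], whose factor 2 cancels the one in
     [2 * gam]. *)
  have := dotv_ge0 (lam0 + l); move: l_le.
  by rewrite /P !enorm_sqr !(dotvBl, dotvBr, dotvDl, dotvDr) (dotvC l lam0); lra.
split.
  move=> eps gam x lam eps0 eps_gam adm t _.
  have /andP[low up] := bounds _ _ _ _ eps0 eps_gam adm t.
  by apply/andP; split=> //; apply: le_trans low; apply: enorm_ge0.
(* The bracket bounds the upper estimate term by term, divided by [eps]: [2 * P / c] uses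
   [eps <= 2 * gam] and [c <= (t + 1) * eps^2], and [Q / 2] uses [gam <= eps]. The factor [rho >= 1]
   serves the lower bound on the objective gap. *)
move=> c c0; exists (rho * (2 * P / c + Q / 2 + M / 2 * E)).
move=> eps gam x lam eps0 eps_gam adm t _ t_ge.
have /andP[low up] := bounds _ _ _ _ eps0 eps_gam adm t.
have /andP[gam_ge gam_le] := eps_gam.
have gam0 : 0 < gam by lra.
set r := enorm (residual _ _ _) in low up *.
have r0 : 0 <= r by apply: enorm_ge0.
have T1 : 1 <= t%:R + 1 :> R by rewrite lerDr ler0n.
have dual_part : P / (gam * (t%:R + 1)) <= eps * (2 * P / c).
  rewrite ler_pdivrMr ?mulr_gt0//.
  have h : c <= (t%:R + 1) * eps ^+ 2.
    by move: t_ge; rewrite ler_pdivrMr ?exprn_gt0// => h; have := sqr_ge0 eps; lra.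
  have -> : eps * (2 * P / c) * (gam * (t%:R + 1))
     = P * ((2 * gam * eps * (t%:R + 1)) / c) by field; rewrite gt_eqF.
  rewrite -[leLHS]mulr1; apply: ler_wpM2l => //; rewrite ler_pdivlMr// mul1r.
  apply: le_trans h _; rewrite expr2 mulrC; apply: ler_wpM2r; first by lra.
  by apply: ler_wpM2r; lra.
have primal_part : gam / (2 * (t%:R + 1)) * Q <= eps * (Q / 2).
  rewrite (_ : eps * _ = eps / 2 * Q); last by field.
  apply: ler_wpM2r => //; rewrite ler_pdivrMr; last by lra.
  have -> : eps / 2 * (2 * (t%:R + 1)) = eps * (t%:R + 1) by field.
  by apply: le_trans gam_le _; rewrite ler_peMr// ltW.
set K := 2 * P / c + Q / 2 + M / 2 * E.
have gapK : objective f (ergodic x t) - objective f us + rho * r <= K * eps.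
  by apply: le_trans up _; rewrite /K /M; lra.
have rK : r <= K * eps by apply: le_trans low gapK.
have K_le : K * eps <= rho * K * eps.
  by rewrite -mulrA ler_peMl// (le_trans r0 rK).
split; last by apply: le_trans rK K_le.
(* The objective gap is at least [- rho * r], since [low] bounds its penalized form below by
   [r >= 0]. *)
have rhor : rho * r <= rho * K * eps by rewrite -mulrA ler_wpM2l//; lra.
have : 0 <= rho * r by rewrite mulr_ge0//; lra.
by rewrite ler_norml => ?; apply/andP; split; lra.
Qed.
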